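(* Let $Q$ be a system of quads of a closed oriented surface of genus at least $2$, and let $H$ be a finite subgraph of the preimage $\widetilde Q$ of $Q$ in the universal covering. Then $|E(H)|\le\frac52|\partial H|$.
   Context: A system of quads on a closed oriented surface $S$ of genus $g$ is the quadrangulation obtained from a graph with one vertex and one face cellularly embedded in $S$ (consisting of $2g$ loops) by adding a new vertex inside the unique face, joining it by $4g$ edges to the $4g$ corners of the face, and then deleting the $2g$ original loops. $\widetilde Q=p^{-1}(Q)$ where $p:\widetilde S\to S$ is the universal covering. A face of $H$ is a face of $\widetilde Q$ whose four boundary edges all belong to $H$. Each edge has two sides; $\partial H$ is the set of sides of edges of $H$ which do not lie in a face of $H$ (boundary edge sides). *)

(* Defs.v *)
From Stdlib Require Import Relations.
From mathcomp Require Import all_boot all_order all_fingroup.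
From mathcomp Require Import boolp.

Set Implicit Arguments.
Unset Strict Implicit.
Unset Printing Implicit Defensive.

(* One-vertex one-face graphs on an oriented surface, as combinatorial maps. *)
(* Darts are 'I_n; [s] is the rotation (cyclic order of darts around the     *)
(* vertex), [a] the edge involution; faces are the orbits of d |-> s (a d).   *)

Definition one_vertex_one_face_map (n : nat) (s a : {perm 'I_n}) : Prop :=
  [/\ (forall d, a (a d) = d),
      (forall d, a d != d),
      (forall d d', fconnect s d d')
    & (forall d d', fconnect (fun x => s (a x)) d d')].

(* The system of quads Q.  Q has two vertices: the original vertex v and the *)
(* new vertex f inside the face.  The corner of the face between darts d and *)
(* s d (around v) is indexed by d : 'I_n; the edge of Q joining f to that    *)
(* corner is also indexed by d.  A dart of Q is (c, b) : 'I_n * bool, with   *)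
(* b = true meaning "traverse c from f to v", b = false "from v to f".       *)

Definition qdart (n : nat) := ('I_n * bool)%type.

Definition flipd n (x : qdart n) : qdart n := (x.1, ~~ x.2).

(* The boundary of the quad of Q associated with the loop {d, a d}, as a     *)
(* closed walk starting at f:  f -(a d)-> v -(s^-1 (a d))-> f -(d)-> v       *)
(* -(s^-1 d)-> f.                                                            *)
Definition quad_walk n (s a : {perm 'I_n}) (d : 'I_n) : seq (qdart n) :=
  [:: (a d, true); ((s^-1)%g (a d), false); (d, true); ((s^-1)%g d, false)].

Definition quad_walks n (s a : {perm 'I_n}) (d : 'I_n) : seq (seq (qdart n)) :=
  [seq rot k (quad_walk s a d) | k <- iota 0 4] ++
  [seq rev (map (@flipd n) (rot k (quad_walk s a d))) | k <- iota 0 4].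

Inductive htp_step n (s a : {perm 'I_n}) : seq (qdart n) -> seq (qdart n) -> Prop :=
| htp_back (p q : seq (qdart n)) (c : 'I_n) (b : bool) :
    htp_step s a (p ++ [:: (c, b); (c, ~~ b)] ++ q) (p ++ q)
| htp_face (p q w : seq (qdart n)) (d : 'I_n) :
    w \in quad_walks s a d -> htp_step s a (p ++ w ++ q) (p ++ q).

Definition htp n (s a : {perm 'I_n}) : relation (seq (qdart n)) :=
  clos_refl_sym_trans _ (htp_step s a).

(* Edge-paths in Q from f to f (directions alternate, starting f -> v). *)
Definition valid_ff n (p : seq (qdart n)) : bool :=
  ~~ odd (size p) && (map snd p == [seq ~~ odd i | i <- iota 0 (size p)]).

(* The universal cover \tilde Q (combinatorial universal cover of the        *)
(* 2-complex Q, based at f).  Its vertices are homotopy classes of edge-paths *)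
(* from f.  Every edge of \tilde Q has exactly one endpoint over f; the edge  *)
(* with f-endpoint [p] (p : path f -> f) lying over the edge c of Q is        *)
(* represented by the pair (p, c); it joins [p] to [p ++ [:: (c, true)]].     *)

Definition cedge n := (seq (qdart n) * 'I_n)%type.

Definition valid_cedge n (e : cedge n) : bool := valid_ff e.1.

Definition cedge_eq n (s a : {perm 'I_n}) (e e' : cedge n) : Prop :=
  e.2 = e'.2 /\ htp s a e.1 e'.1.

(* The four boundary edges of the face of \tilde Q lying over the quad of    *)
(* the loop {d, a d}, whose boundary walk (quad_walk) is lifted at [p].      *)
Definition face_edges n (s a : {perm 'I_n}) (p : seq (qdart n)) (d : 'I_n)
  : seq (cedge n) :=
  let p' := p ++ [:: (a d, true); ((s^-1)%g (a d), false)] in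
  [:: (p, a d); (p', (s^-1)%g (a d)); (p', d); (p, (s^-1)%g d)].

(* The two sides of the edge (p, c): side [false] lies in the lift at [p] of *)
(* the quad of the loop {s c, a (s c)}, side [true] in the lift at [p] of    *)
(* the quad of the loop {c, a c}.  We return the boundary edges of the face  *)
(* of \tilde Q containing the given side.                                    *)
Definition side_face n (s a : {perm 'I_n}) (e : cedge n) (b : bool) : seq (cedge n) :=
  if b then face_edges s a e.1 (a e.2) else face_edges s a e.1 (s e.2).

(* A finite subgraph H of \tilde Q, given by its (finite) edge set: a list of *)
(* representatives of pairwise distinct edges.                               *)
Definition finite_edge_set n (s a : {perm 'I_n}) (H : seq (cedge n)) : Prop :=
  all (@valid_cedge n) H /\
  (forall i j : 'I_(size H),
      cedge_eq s a (tnth (in_tuple H) i) (tnth (in_tuple H) j) -> i = j).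

Definition in_H n (s a : {perm 'I_n}) (H : seq (cedge n)) (e : cedge n) : Prop :=
  exists2 e', e' \in H & cedge_eq s a e e'.

Definition face_of_H n (s a : {perm 'I_n}) (H : seq (cedge n)) (F : seq (cedge n)) : Prop :=
  forall e, e \in F -> in_H s a H e.

Definition boundary_sides n (s a : {perm 'I_n}) (H : seq (cedge n))
  : {set ('I_(size H) * bool)} :=
  [set x : 'I_(size H) * bool |
     ~~ `[< face_of_H s a H (side_face s a (tnth (in_tuple H) x.1) x.2) >] ].

(* Main.v *)
Require Import Defs.
From Stdlib Require Import Relations.
From mathcomp Require Import all_boot all_order all_fingroup all_algebra.
From mathcomp Require Import zify boolp.

Set Implicit Arguments.
Unset Strict Implicit.
Unset Printing Implicit Defensive.

(* Let K be a finite set of faces of the universal cover.  First fill its       *)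
(* holes: every closed walk bounds modulo 2, so adding to K a filling of every  *)
(* cycle of its 1-skeleton gives K' with H_1(K'; F_2) = 0, at least as many     *)
(* faces, and no new frontier edge.  Exactness gives E <= V + F for K'.         *)
(* Turning around a vertex, either all of its 4g >= 8 corners lie in K' or some *)
(* frontier edge leaves K', whence V <= F / 2 + D for D frontier edges; with    *)
(* 2 E = 4 F + D this yields F <= D.  For the faces of H one has                *)
(* 2 |E(H)| = 4 F + |dH| and D <= |dH|, which gives the bound.                  *)

Import GRing.Theory.

(** All vertices of the quadrangulation have degree [4 * g], at least 8, so the universal cover is
    negatively curved and a finite set of faces is bounded linearly by its frontier. Simple
    connectedness enters only modulo 2, through [bounds_htp] and [cycle_bounds]. Once [hull] has
    removed the holes, [euler] is a rank count over ['F_2] and needs no planarity argument. With the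
    degree count of [count_rotation] it yields [isoperimetric]: at most as many faces as frontier
    edges. In [size_leq_boundary] the constant 5 is 4 sides per face plus 1 for the boundary sides
    themselves. *)

(** * Linear algebra and counting preliminaries *)

(** Rank-nullity: the kernel of [B1] has dimension at least [e - v], the row space of [B2] at most
    [f]. *)
Lemma leq_rank_exact (F : fieldType) (e v f : nat)
    (B1 : 'M[F]_(e, v)) (B2 : 'M[F]_(f, e)) :
  (forall u : 'rV_e, u *m B1 = 0 -> (u <= B2)%MS)%R -> e <= v + f.
Proof.
move=> exact12.
have sub12 : (kermx B1 <= B2)%MS.
  by apply/row_subP => i; apply: exact12; rewrite -row_mul mulmx_ker row0.
have := mxrankS sub12; rewrite mxrank_ker.
have := rank_leq_col B1; have := rank_leq_row B2; lia.
Qed.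

Lemma sum_F2 N (u : 'rV['F_2]_N) (p : pred 'I_N) :
  (\sum_i u 0 i * (p i)%:R = (count p [seq i <- enum 'I_N | u 0 i != 0])%:R)%R.
Proof.
rewrite -sum1_count natr_sum big_filter_cond big_enum_cond /= [RHS]big_mkcond /=.
apply: eq_bigr => i _; case: (p i); rewrite ?andbF ?mulr0 // andbT mulr1.
by case: (u 0%R i) => [[|[|]]] // lt2; apply: val_inj.
Qed.

Lemma natr_F2_eq0 m : (m%:R == 0 :> 'F_2)%R = ~~ odd m.
Proof. by rewrite -(dvdn_pcharf (pchar_Fp _)) // dvdn2. Qed.

Lemma addb_F2 (b c : bool) : ((b (+) c)%:R = b%:R + c%:R :> 'F_2)%R.
Proof. by case: b c => [] []; apply: val_inj. Qed.

Lemma sum_delta (R : pzRingType) (T : eqType) (F : seq T) (f : T -> R) x : uniq F ->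
  (\sum_(k < size F) f (tnth (in_tuple F) k) * (x == tnth (in_tuple F) k)%:R
   = if x \in F then f x else 0)%R.
Proof.
move=> uF; rewrite -(big_tnth _ _ F xpredT (fun k => f k * (x == k)%:R)%R) /=.
case: ifPn => [xF|xF].
  rewrite (bigD1_seq x) //= eqxx mulr1 big1 ?addr0 // => k /negbTE.
  by rewrite eq_sym => ->; rewrite mulr0.
rewrite big1_seq // => k /andP[_ kF]; case: eqP => [xk|_]; last by rewrite mulr0.
by rewrite xk kF in xF.
Qed.

Lemma big_addb_even (T : eqType) (r : seq T) (f : T -> bool) :
  (forall x, ~~ odd (count_mem x r)) -> \big[addb/false]_(x <- r) f x = false.
Proof.
move=> even_r; rewrite -big_undup_iterop_count big1_seq // => x _.
have := even_r x; case: (count_mem x r) => [|m] //; rewrite iteropS /= negbK.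
suff -> : iter m (addb (f x)) (f x) = ~~ odd m && f x by move=> ->.
by elim: m => //= m ->; case: (odd m); case: (f x).
Qed.

(** A vertex with all [n] corners in [K] uses up [n] elements of [K]. At any other vertex of [V],
    turning from a corner in [K] to one outside leaves [K] at some step, which puts the vertex in
    [B]. The map [corner] is a parameter because corners at both kinds of vertices will be named by
    f-corners. *)
Lemma count_rotation (n : nat) (T C : eqType) (corner : T * 'I_n -> C)
    (r : 'I_n -> 'I_n) (K : seq C) (V B : seq T) :
  injective corner -> (forall d d', fconnect r d d') -> uniq V ->
  (forall x, x \in V -> exists d, corner (x, d) \in K) ->
  (forall x d, corner (x, d) \in K -> corner (x, r d) \notin K -> x \in B) ->
  n * size V <= size K + n * size B.
Proof.
move=> inj_corner transr uniqV VK Bout.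
pose full x := all (fun d => corner (x, d) \in K) (enum 'I_n).
have szfull : n * size (filter full V) <= size K.
  pose s := [seq corner (x, d) | x <- filter full V, d <- enum 'I_n].
  have -> : n * size (filter full V) = size s.
    by rewrite size_allpairs size_enum_ord mulnC.
  apply: uniq_leq_size.
    apply: allpairs_uniq => [||[x d] [x' d'] _ _ /inj_corner //].
      exact: filter_uniq.
    exact: enum_uniq.
  move=> _ /allpairsP[[x d] /= [+ _ ->]]; rewrite mem_filter => /andP[/allP fx _].
  by apply: fx; rewrite mem_enum.
have szpart : size (filter (predC full) V) <= size B.
  apply: uniq_leq_size; first exact: filter_uniq.
  move=> x; rewrite mem_filter /= => /andP[/allPn[d1 _ d1K] /VK[d0 d0K]].
  have /iter_findex := transr d0 d1; move: (findex _ _ _) => k def_d1.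
  elim: k d1 d1K def_d1 => [|k IHk] d1 d1K /=; first by move=> e; rewrite -e d0K in d1K.
  case: (boolP (corner (x, iter k r d0) \in K)) => [ink|outk] def_d1.
    by apply: Bout ink _; rewrite def_d1.
  exact: IHk outk _.
have := count_predC full V; rewrite -!size_filter => <-; rewrite mulnDr.
by rewrite leq_add // leq_mul2l szpart orbT.
Qed.

(** * Vertices of the universal cover as homotopy classes of words *)

Section Cover.

Variables (n : nat) (s a : {perm 'I_n}).

Notation word := (seq (qdart n)).

Definition htpb : rel word := fun p q => `[< htp s a p q >].

Lemma htpb_refl : reflexive htpb.
Proof. by move=> p; apply/asboolP; apply: rst_refl. Qed.

Lemma htpb_sym : symmetric htpb.
Proof. by move=> p q; apply/asboolP/asboolP; apply: rst_sym. Qed.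

Lemma htpb_trans : transitive htpb.
Proof. by move=> q p r /asboolP pq /asboolP qr; apply/asboolP; apply: rst_trans pq qr. Qed.

Canonical htpb_equiv := EquivRel htpb htpb_refl htpb_sym htpb_trans.

(* Classes of arbitrary words: those of words that are not edge paths of Q      *)
(* index further components of the same complex.                                *)
Notation cls := {eq_quot htpb_equiv}%qT.

Definition pic (p : word) : cls := (\pi_cls p)%qT.

Definition rep (x : cls) : word := generic_quotient.repr x.

Lemma picP p q : pic p = pic q <-> htp s a p q.
Proof. by split=> [/eqmodP/asboolP|pq] //; apply/eqmodP/asboolP. Qed.

Lemma pic_rep x : pic (rep x) = x.
Proof. exact: reprK. Qed.

Definition mv (x : cls) (l : qdart n) : cls := pic (rcons (rep x) l).

Lemma htp_rcons p q l : htp s a p q -> htp s a (rcons p l) (rcons q l).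
Proof.
elim=> {p q} [p q []|p|p q _|p q r _ IHp _ IHq].
- by move=> p0 q0 c b; rewrite -!cats1 -!catA; apply/rst_step/htp_back.
- by move=> p0 q0 w d wd; rewrite -!cats1 -!catA; apply/rst_step/(htp_face _ _ wd).
- exact: rst_refl.
- exact: rst_sym.
- exact: rst_trans IHp IHq.
Qed.

Lemma mv_pic p l : mv (pic p) l = pic (rcons p l).
Proof. by apply/picP/htp_rcons/picP; rewrite pic_rep. Qed.

Definition run (x : cls) (w : word) : cls := foldl mv x w.

Lemma run_pic p w : run (pic p) w = pic (p ++ w).
Proof.
by elim: w p => [|l w IHw] p /=; rewrite ?cats0 // mv_pic IHw cat_rcons.
Qed.

Lemma run_back x c b : run x [:: (c, b); (c, ~~ b)] = x.
Proof.
rewrite -(pic_rep x) run_pic; apply/picP/rst_step.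
by have := htp_back s a (rep x) [::] c b; rewrite !cats0.
Qed.

Lemma mvK x l : mv (mv x l) (flipd l) = x.
Proof. by case: l => c b; apply: run_back. Qed.

Lemma run_face x w d : w \in quad_walks s a d -> run x w = x.
Proof.
move=> wd; rewrite -(pic_rep x) run_pic; apply/picP/rst_step.
by have := htp_face (rep x) [::] wd; rewrite !cats0.
Qed.

Notation corner := (cls * 'I_n)%type.

(** * Lifted walks, faces and boundaries modulo 2 *)

(** An edge is named by its endpoint over f: the start of a dart from f to v, the end of a dart from
    v to f. *)
Definition dart_edge (x : cls) (l : qdart n) : corner :=
  (if l.2 then x else mv x l, l.1).

Fixpoint lift (x : cls) (w : word) : seq corner :=
  if w is l :: w' then dart_edge x l :: lift (mv x l) w' else [::].

Lemma lift_cat x p q : lift x (p ++ q) = lift x p ++ lift (run x p) q.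
Proof. by elim: p x => //= l p IHp x; rewrite IHp. Qed.

Lemma run_rev_flip x w : run (run x w) (rev (map (@flipd n) w)) = x.
Proof.
elim: w x => //= l w IHw x.
by rewrite rev_cons -cats1 /run foldl_cat -/(run _ _) -/(run _ _) IHw /= mvK.
Qed.

Lemma lift_rev_flip x w :
  lift (run x w) (rev (map (@flipd n) w)) = rev (lift x w).
Proof.
elim: w x => //= l w IHw x.
rewrite !rev_cons -!cats1 lift_cat IHw run_rev_flip /=; congr (_ ++ [:: _]).
by rewrite /dart_edge; case: l => c [] /=; rewrite ?(mvK _ (c, true)).
Qed.

(* [corner] is the type both of edges of the universal cover and of f-corners:  *)
(* as an f-corner, (x, d) stands for the lift at x of the quad of {d, a d}, and *)
(* [across] maps it to the other f-corner of the same face.                     *)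
Definition opp_f (x : cls) (d : 'I_n) : cls :=
  mv (mv x (a d, true)) ((s^-1)%g (a d), false).

Definition across (k : corner) : corner := (opp_f k.1 k.2, a k.2).

Definition face (k : corner) : seq corner :=
  [:: (k.1, a k.2); (opp_f k.1 k.2, (s^-1)%g (a k.2));
      (opp_f k.1 k.2, k.2); (k.1, (s^-1)%g k.2)].

Definition side (e : corner) (b : bool) : corner :=
  (e.1, if b then a e.2 else s e.2).

(** The boundary map modulo 2 from faces to edges. A set of faces is encoded by its f-corners, hence
    as a predicate invariant under [across]; each side of an edge is an f-corner of the face on that
    side. *)
Definition bd (phi : pred corner) : pred corner :=
  fun e => phi (side e true) (+) phi (side e false).

Definition bounds (z : pred corner) : Prop :=
  exists phi : pred corner,
    [/\ exists ks : seq corner, {subset phi <= ks},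
        forall k, phi (across k) = phi k & z =1 bd phi].

Definition parity (es : seq corner) : pred corner := fun e => odd (count_mem e es).

Lemma bounds0 (z : pred corner) : z =1 xpred0 -> bounds z.
Proof. by move=> z0; exists xpred0; split=> //; exists [::]. Qed.

Lemma bounds_add z1 z2 (z : pred corner) :
  bounds z1 -> bounds z2 -> (forall e, z e = z1 e (+) z2 e) -> bounds z.
Proof.
move=> [f1 [[k1 sub1] inv1 bd1]] [f2 [[k2 sub2] inv2 bd2]] zE.
exists (fun k => f1 k (+) f2 k); split.
- exists (k1 ++ k2) => k; rewrite mem_cat unfold_in.
  by case f1k: (f1 k) => /=; [rewrite sub1 | move/sub2=> ->; rewrite orbT].
- by move=> k; rewrite inv1 inv2.
- by move=> e; rewrite zE bd1 bd2 /bd addbACA.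
Qed.

Hypothesis aK : forall d, a (a d) = d.

Lemma across_quad k : run k.1 (quad_walk s a k.2) = k.1.
Proof.
apply: (@run_face _ _ k.2); rewrite mem_cat; apply/orP; left.
by apply/mapP; exists 0; rewrite ?rot0.
Qed.

(** The boundary walk of a quad closes up, and its second half is the first half of the walk for
    [a d] started at the opposite f-vertex. *)
Lemma acrossK : involutive across.
Proof.
case=> x d; rewrite /across /= aK; congr (_, _).
by have := across_quad (x, d); rewrite /= /opp_f aK.
Qed.

Lemma lift_quad x d : lift x (quad_walk s a d) = face (x, d).
Proof.
have := across_quad (x, d); rewrite /= /face /dart_edge /= /opp_f => ->.
by [].
Qed.

Lemma lift_quad_walks x w d :
  w \in quad_walks s a d -> exists y, perm_eq (lift x w) (face (y, d)).
Proof.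
have liftrot k y : k \in iota 0 4 ->
    run y (rot k (quad_walk s a d)) = y /\
    exists z, perm_eq (lift y (rot k (quad_walk s a d))) (face (z, d)).
  move=> k4; have closed u : run u (rot k (quad_walk s a d)) = u.
    by apply: (@run_face _ _ d); rewrite mem_cat; apply/orP; left; apply/mapP; exists k.
  split=> //; move: {k4} (quad_walk s a d) (lift_quad^~ d) closed => w0 liftw0 closed.
  (* After [drop k w0] the rotated walk stands where a lift of [w0] itself starts. *)
  exists (run y (drop k w0)); rewrite -liftw0 -{3}(cat_take_drop k w0) /rot.
  rewrite !lift_cat -{1}[y](closed y) /rot.
  rewrite perm_catC perm_cat2l {1}/run foldl_cat -/(run _ _) -/(run _ _).
  have := closed y; rewrite /rot {1}/run foldl_cat -/(run _ _) -/(run _ _) => ->.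
  by rewrite perm_refl.
rewrite mem_cat => /orP[] /mapP[k k4 ->]; have [runk [y permk]] := liftrot k x k4.
  by exists y.
by exists y; rewrite -{1}runk lift_rev_flip perm_rev.
Qed.

(** The first and last edges of [face k] have [k] as a side, the two middle ones have [across k]. *)
Lemma parity_face k : 
  parity (face k) =1 bd (fun q => (q == k) (+) (q == across k)).
Proof.
move=> [y c]; case: k => x d; rewrite /parity /bd /face /side /across /=.
rewrite !xpair_eqE !oddD !oddb /=.
rewrite ![_ == y]eq_sym.
have e1 u : (a c == u) = (a u == c) by apply/eqP/eqP => <-; rewrite aK.
have e2 u : (s c == u) = ((s^-1)%g u == c).
  by apply/eqP/eqP => <-; rewrite ?permK ?permKV.
rewrite !e1 !e2 aK.
by do 2!case: (y == _); do 4!case: (_ == c).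
Qed.

Lemma bounds_face k : bounds (parity (face k)).
Proof.
exists (fun q => (q == k) (+) (q == across k)); split; last exact: parity_face.
- exists [:: k; across k] => q; rewrite unfold_in !inE.
  by case: (q == k); case: (q == across k).
- by move=> q; rewrite (can_eq acrossK) (can2_eq acrossK acrossK) addbC.
Qed.

Lemma parity_perm es1 es2 : perm_eq es1 es2 -> parity es1 =1 parity es2.
Proof. by move=> /seq.permP eq12 e; rewrite /parity eq12. Qed.

Lemma parity_cat es1 es2 e : parity (es1 ++ es2) e = parity es1 e (+) parity es2 e.
Proof. by rewrite /parity count_cat oddD. Qed.

(** * Vanishing of the first homology of the cover modulo 2 *)

(** Each elementary homotopy inserts or deletes a closed piece, which changes the lift by an edge
    counted twice or by the boundary of one face. *)
Lemma bounds_htp p q : htp s a p q ->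
  bounds (fun e => parity (lift (pic [::]) p) e (+) parity (lift (pic [::]) q) e).
Proof.
have loop p0 w q0 : (forall x, run x w = x) -> (forall x, bounds (parity (lift x w))) ->
    bounds (fun e => parity (lift (pic [::]) (p0 ++ w ++ q0)) e
                     (+) parity (lift (pic [::]) (p0 ++ q0)) e).
  move=> closed bw; have := bw (run (pic [::]) p0) => bw0.
  apply: bounds_add bw0 (bounds0 (fun=> erefl)) _ => e.
  rewrite !lift_cat closed !parity_cat.
  by do 3!case: (parity _ e).
elim=> {p q} [p q []|p|p q _|p q r _ IHp _ IHq].
- move=> p0 q0 c b; apply: loop => x; first exact: run_back.
  apply: bounds0 => e; rewrite /parity /= addn0.
  have -> : dart_edge (mv x (c, b)) (c, ~~ b) = dart_edge x (c, b).
    by rewrite /dart_edge; case: b => //=; rewrite (mvK _ (c, true)).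
  by rewrite addnn odd_double.
- move=> p0 q0 w d wd; apply: loop => x; first exact: run_face wd.
  have [y permw] := lift_quad_walks x wd.
  apply: bounds_add (bounds_face (y, d)) (bounds0 (fun=> erefl)) _ => e.
  by rewrite (parity_perm permw) addbF.
- by apply: bounds0 => e; rewrite addbb.
- by move=> bpq; apply: bounds_add bpq (bounds0 (fun=> erefl)) _ => e; rewrite addbF addbC.
- apply: bounds_add IHp IHq _ => e; by do 3!case: (parity _ e).
Qed.

Definition head_of (e : corner) : cls := mv e.1 (e.2, true).

(* The chosen paths from the base point to the two ends of an edge e form with  *)
(* e a closed path, which bounds; summed over a cycle, these paths cancel.      *)
Lemma cycle_bounds (es : seq corner) :
  (forall x, ~~ odd (count (fun e => e.1 == x) es)) ->
  (forall y, ~~ odd (count (fun e => head_of e == y) es)) ->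
  bounds (parity es).
Proof.
pose T x := parity (lift (pic [::]) (rep x)).
have bcone e : bounds (fun u => parity [:: e] u (+) (T e.1 u (+) T (head_of e) u)).
  have h : htp s a (rcons (rep e.1) (e.2, true)) (rep (head_of e)).
    by apply/picP; rewrite pic_rep.
  apply: bounds_add (bounds_htp h) (bounds0 (fun=> erefl)) _ => u.
  rewrite -cats1 lift_cat parity_cat run_pic pic_rep /= /dart_edge /=.
  by rewrite -surjective_pairing addbF addbA [parity [:: e] u (+) _]addbC.
have bcones : bounds (fun u => parity es u (+)
    (\big[addb/false]_(e <- es) T e.1 u (+) \big[addb/false]_(e <- es) T (head_of e) u)).
  elim: es => [|e es IHes]; first by apply: bounds0 => u; rewrite !big_nil.
  apply: bounds_add (bcone e) IHes _ => u; rewrite !big_cons -cat1s parity_cat.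
  by rewrite (addbACA (T e.1 u)) addbACA.
move=> ev1 ev2; apply: bounds_add bcones (bounds0 (fun=> erefl)) _ => u.
rewrite -(big_map fst xpredT (fun x => T x u)) -(big_map head_of xpredT (fun x => T x u)).
by rewrite !big_addb_even ?addbF // => x; rewrite count_map; [apply: ev2|apply: ev1].
Qed.


(** * Filling the holes of a finite set of faces *)

Lemma bdE phi e b : bd phi e = phi (side e b) (+) phi (side e (~~ b)).
Proof. by case: b; rewrite // addbC. Qed.

Definition unside (b : bool) (k : corner) : corner :=
  (k.1, if b then a k.2 else (s^-1)%g k.2).

Lemma sideK b : cancel (side^~ b) (unside b).
Proof. by case: b => [] [x c]; rewrite /side /unside /= ?aK ?permK. Qed.

Lemma unsideK b : cancel (unside b) (side^~ b).
Proof. by case: b => [] [x c]; rewrite /side /unside /= ?aK ?permKV. Qed.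

Definition edges_of (K : seq corner) : seq corner :=
  undup (map (unside true) K ++ map (unside false) K).

Lemma mem_edges_of K e b :
  (e \in edges_of K) = (side e b \in K) || (side e (~~ b) \in K).
Proof.
have mem_side b' : (e \in map (unside b') K) = (side e b' \in K).
  by rewrite -{1}(sideK b' e) (mem_map (can_inj (unsideK b'))).
by rewrite mem_undup mem_cat !mem_side; case: b; rewrite // orbC.
Qed.

(** Only finitely many chains live on the edges of [K], so finitely many fillings suffice. The
    fillings bring in new edges, yet no new cycle has to be filled: the part of a filling outside
    [K'] has its boundary on the edges of [K]. *)
Lemma hull (K : seq corner) :
  (forall k, (across k \in K) = (k \in K)) ->
  exists K' : seq corner,
    [/\ uniq K', {subset K <= K'}, forall k, (across k \in K') = (k \in K'),
        forall e b, side e b \in K' -> side e (~~ b) \notin K' -> side e b \in K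
      & forall z : pred corner, bounds z -> {subset z <= edges_of K'} ->
        exists phi : pred corner,
          [/\ {subset phi <= K'}, forall k, phi (across k) = phi k & z =1 bd phi]].
Proof.
move=> invK; pose E := edges_of K.
(* Subsets of [E] are coded by masks; a subset that does not bound gets the empty filling. *)
have fill (m : bitseq) : exists f : pred corner * seq corner,
    [/\ {subset f.1 <= f.2}, forall k, f.1 (across k) = f.1 k,
        forall e, bd f.1 e -> e \in E
      & bounds (mem (mask m E)) -> mem (mask m E) =1 bd f.1].
  case: (pselect (bounds (mem (mask m E)))) => [bm|nbm]; last first.
    by exists (xpred0, [::]); split.
  have [phi [[ks sub] inv bdphi]] := bm.
  by exists (phi, ks); split=> // e; rewrite -bdphi => /mem_mask.
have {fill} [f fP] := choice fill.
pose ms := [seq val t | t <- enum {: (size E).-tuple bool}].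
pose K' := undup (K ++ flatten [seq filter (f m).1 (f m).2 | m : bitseq <- ms]).
have memK' k : reflect (k \in K \/ exists2 m, m \in ms & (f m).1 k) (k \in K').
  rewrite mem_undup mem_cat; apply: (iffP orP).
    case=> [|/flatten_mapP[m mms]]; first by left.
    by rewrite mem_filter => /andP[fk _]; right; exists m.
  case=> [|[m mms fk]]; [by left | right].
  apply/flatten_mapP; exists m; rewrite // mem_filter fk /=.
  by have [sub _ _ _] := fP m; apply: sub.
have subK : {subset K <= K'} by move=> k kK; apply/memK'; left.
(* An edge with exactly one side in a filling lies on its boundary, hence in [E], so one of its
   sides is in [K]; it is not the side outside [K']. *)
have bdryK e b : side e b \in K' -> side e (~~ b) \notin K' -> side e b \in K.
  move=> /memK'[//|[m mms fb]] nb.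
  have /negbTE fnb : ~~ (f m).1 (side e (~~ b)).
    by apply: contra nb => fnb; apply/memK'; right; exists m.
  have [_ _ bdE' _] := fP m; have := bdE' e; rewrite (bdE _ _ b) fb fnb /=.
  move=> /(_ isT); rewrite (mem_edges_of _ _ b) => /orP[//|nbK].
  by rewrite subK in nb.
have invK' k : (across k \in K') = (k \in K').
  apply/memK'/memK'; case=> [|[m mms fk]].
  - by rewrite invK; left.
  - by right; exists m => //; have [_ <- _ _] := fP m.
  - by left; rewrite invK.
  - by right; exists m => //; have [_ -> _ _] := fP m.
exists K'; split; rewrite ?undup_uniq //.
move=> z [phi [[ks sub] inv bdphi]] zE.
(* The part of the filling outside K' has its boundary in K, so it can be *)
(* replaced by the filling of that boundary chosen when K' was built.     *)
pose out k := phi k && (k \notin K').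
have outE e : bd out e -> e \in E.
  have side_out b : out (side e b) -> ~~ out (side e (~~ b)) -> e \in E.
    rewrite /out => /andP[phib nb] /nandP[nphi|]; last first.
      rewrite negbK => inb; rewrite (mem_edges_of _ _ (~~ b)); apply/orP; left.
      by apply: bdryK; rewrite ?negbK.
    have : e \in z by rewrite unfold_in bdphi (bdE _ _ b) phib (negbTE nphi).
    move/zE; rewrite (mem_edges_of _ _ b) (negbTE nb) /= => inb.
    rewrite (mem_edges_of _ _ (~~ b)); apply/orP; left.
    by apply: bdryK; rewrite ?negbK.
  rewrite /bd; have := side_out true; have := side_out false => /=.
  by case: (out _) => [] h1; case: (out _) h1 => [] h1 h2 // _; [apply: h1|apply: h2].
pose m := map (bd out) E.
have mE : mem (mask m E) =1 bd out.
  move=> e; rewrite -filter_mask /= mem_filter.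
  by case: (boolP (bd out e)) => // /outE.
have bout : bounds (mem (mask m E)).
  exists out; split=> //.
  - by exists ks => k /andP[phik _]; apply: sub.
  - by move=> k; rewrite /out inv invK'.
have mms : m \in ms.
  have szm : size m == size E by rewrite size_map.
  by apply/mapP; exists (Tuple szm); rewrite ?mem_enum.
have [_ invf _ /(_ bout) bdf] := fP m.
exists (fun k => (phi k && (k \in K')) (+) (f m).1 k); split.
- move=> k; rewrite unfold_in; case: (boolP (k \in K')) => // nk.
  by rewrite andbF /= => fk; case/memK': nk; right; exists m.
- by move=> k; rewrite inv invK' invf.
- move=> e; rewrite bdphi; have := bdf e; rewrite mE /bd /out => bde.
  rewrite addbACA -bde.
  by do 2!(case: (_ \in K'); rewrite ?andbT ?andbF ?addbF ?addFb //=);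
    rewrite ?addbF // addbC.
Qed.


(** * The Euler inequality *)

Lemma euler (K : seq corner) : (forall d, a d != d) -> uniq K ->
  (forall k, (across k \in K) = (k \in K)) ->
  (forall z : pred corner, bounds z -> {subset z <= edges_of K} ->
     exists phi : pred corner,
       [/\ {subset phi <= K}, forall k, phi (across k) = phi k & z =1 bd phi]) ->
  (size (edges_of K)).*2 <=
    (size (undup (map fst (edges_of K)))
     + size (undup (map head_of (edges_of K)))).*2 + size K.
Proof.
move=> a_neq uK invK exactK; set E := edges_of K.
set Vf := undup _; set Vv := undup _.
(* [K] holds each face twice, once per f-corner; [F] keeps one of the two and [q] sends an f-corner
   to the one kept. *)
pose F := [seq k : corner <- K | k.2 < a k.2].
have szF : (size F).*2 <= size K.
  rewrite -addnn -(count_predC (fun k : corner => k.2 < a k.2) K) -size_filter leq_add2l.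
  rewrite -size_filter -(size_map across F); apply: uniq_leq_size.
    by rewrite (map_inj_uniq (can_inj acrossK)) filter_uniq.
  move=> _ /mapP[k + ->]; rewrite !mem_filter /= invK aK => /andP[lt ->].
  by rewrite -leqNgt ltnW.
suff : size E <= (size Vf + size Vv) + size F by lia.
pose q (k : corner) := if k.2 < a k.2 then k else across k.
have qF k : (q k \in F) = (k \in K).
  rewrite /q mem_filter; case: ifPn => [->|] //; rewrite invK /= aK -leqNgt leq_eqVlt.
  by rewrite -[(_ == _ :> nat)]/(a k.2 == k.2) (negbTE (a_neq _)) /= => ->.
have uE : uniq E by apply: undup_uniq.
have uF : uniq F by apply: filter_uniq.
pose e_ := tnth (in_tuple E); pose f_ := tnth (in_tuple F).
have injE : injective e_ by apply/tuple_uniqP.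
pose M1 : 'M['F_2]_(_, _) :=
  (\matrix_(i < size E, j < size Vf) ((e_ i).1 == tnth (in_tuple Vf) j)%:R)%R.
pose M2 : 'M['F_2]_(_, _) :=
  (\matrix_(i < size E, j < size Vv) (head_of (e_ i) == tnth (in_tuple Vv) j)%:R)%R.
pose B2 : 'M['F_2]_(_, _) := (\matrix_(k < size F, i < size E)
  ((q (side (e_ i) true) == f_ k)%:R + (q (side (e_ i) false) == f_ k)%:R))%R.
apply: (@leq_rank_exact 'F_2 _ _ _ (row_mx M1 M2) B2) => u.
rewrite mul_mx_row => uM.
have [uM1 uM2] : (u *m M1 = 0 /\ u *m M2 = 0)%R.
  by apply: eq_row_mx; rewrite uM row_mx0.
pose es := [seq e_ i | i <- enum 'I_(size E) & u 0%R i != 0%R].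
(* A vector killed by an incidence matrix is supported on edges meeting every vertex of that kind an
   even number of times. *)
have even_end (V : seq cls) (h : corner -> cls) :
    {subset map h E <= V} ->
    (u *m (\matrix_(i < size E, j < size V) (h (e_ i) == tnth (in_tuple V) j)%:R) = 0)%R ->
    forall x, ~~ odd (count (fun e => h e == x) es).
  move=> hV uM0 x; case: (boolP (x \in in_tuple V)) => [/tnthP[j xE]|xV]; last first.
    rewrite (eq_in_count (a2 := pred0)) ?count_pred0 // => _ /mapP[i _ ->] /=.
    apply: contraNF xV => /eqP <-; apply: hV; apply/map_f/mem_tnth.
  move/rowP/(_ j): uM0; rewrite !mxE => uM0.
  rewrite -natr_F2_eq0 count_map -(sum_F2 u (fun i => h (e_ i) == x)).
  by rewrite -[X in _ == X]uM0; apply/eqP/eq_bigr => i _; rewrite mxE xE.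
have bes : bounds (parity es).
  apply: cycle_bounds.
    by apply: (even_end Vf fst) => // e; rewrite mem_undup.
  by apply: (even_end Vv head_of) => // e; rewrite mem_undup.
have ues : uniq es by rewrite map_inj_uniq // filter_uniq // enum_uniq.
have parE e : parity es e = (e \in es).
  by rewrite /parity count_uniq_mem // oddb.
have [phi [subphi invphi bdphi]] : exists phi : pred corner,
    [/\ {subset phi <= K}, forall k, phi (across k) = phi k & parity es =1 bd phi].
  apply: exactK => // e; rewrite -[_ \in _]/(parity es e) parE => /mapP[i _ ->].
  exact: mem_tnth.
(* The filling [phi], read on the chosen f-corners, gives the coefficients. *)
apply/submxP; exists (\row_k (phi (f_ k))%:R)%R.
apply/rowP => i; rewrite !mxE.
have -> : (u 0 i = (parity es (e_ i))%:R)%R.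
  rewrite parE mem_map // mem_filter mem_enum andbT.
  by case: (u 0%R i) => [[|[|]]] // lt2; apply: val_inj.
have phiq c : (\sum_k (phi (f_ k))%:R * (q c == f_ k)%:R = (phi c)%:R :> 'F_2)%R.
  rewrite (sum_delta (fun k => (phi k)%:R)%R) // qF.
  have -> : phi (q c) = phi c by rewrite /q; case: ifP.
  by case: ifPn => // /negbTE; case: (boolP (phi c)) => // /subphi ->.
rewrite bdphi /bd addb_F2 -!phiq -big_split /=.
by apply: eq_bigr => k _; rewrite !mxE mulrDr.
Qed.

(** * The isoperimetric inequality *)

Definition frontier (K : seq corner) (b : bool) : seq corner :=
  [seq e <- edges_of K | (side e b \in K) && (side e (~~ b) \notin K)].

Lemma across_side y c :
  across (mv y (c, false), a c) = (mv y ((s^-1)%g c, false), c).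
Proof. by rewrite /across /opp_f /= aK (mvK y (c, false)). Qed.

(** With [V] vertices, [E] edges and [D] frontier edges for the hull [K'], the proof combines
    [2E <= 2V + |K'|], [2|K'| + D <= 2E] and [V <= |K'|/4 + D] into [|K'| <= 2D]. The last bound
    needs each frontier edge charged to one endpoint only: to its f-end if its [true] side is
    inside, to its v-end if its [false] side is. *)
Lemma isoperimetric (K : seq corner) :
  8 <= n -> (forall d, a d != d) -> (forall d d', fconnect s d d') ->
  (forall d d', fconnect (fun x => s (a x)) d d') ->
  uniq K -> (forall k, (across k \in K) = (k \in K)) ->
  size K <= (size (frontier K true) + size (frontier K false)).*2.
Proof.
move=> n8 a_neq transs transf uK invK.
have [K' [uK' subK invK' bdryK exactK]] := hull invK.
have le_size : size K <= size K' by apply: uniq_leq_size.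
have le_frontier b : size (frontier K' b) <= size (frontier K b).
  apply: uniq_leq_size; first by rewrite filter_uniq ?undup_uniq.
  move=> e; rewrite !mem_filter => /andP[/andP[inb nb] _].
  rewrite (mem_edges_of _ _ b) (bdryK _ _ inb nb) /= andbT.
  by apply: contra nb => /subK.
have := euler a_neq uK' invK' exactK.
set E := edges_of K'; set Vf := undup _; set Vv := undup _ => euler'.
have szE b : size K' + size (frontier K' (~~ b)) <= size E.
  rewrite -(count_predC (fun e => side e b \in K') E) leq_add //.
    rewrite -size_filter -(size_map (unside b) K'); apply: uniq_leq_size.
      by rewrite (map_inj_uniq (can_inj (unsideK b))).
    move=> _ /mapP[k kK ->].
    by rewrite mem_filter (mem_edges_of _ _ b) (unsideK b) kK.
  by rewrite size_filter; apply: sub_count => e /=; rewrite negbK => /andP[].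
have szVf : n * size Vf <= size K' + n * size (frontier K' true).
  rewrite -(size_map fst (frontier K' true)).
  apply: (count_rotation (corner := id)) transf (undup_uniq _) _ _ => //.
    move=> x; rewrite mem_undup => /mapP[e eE ->].
    by move: eE; rewrite (mem_edges_of _ _ true) => /orP[]; eexists; eassumption.
  move=> x d xd xr; apply/mapP; exists (x, a d) => //.
  by rewrite mem_filter (mem_edges_of _ _ true) /side /= aK xd xr.
(* The v-corner at [y] between the edges over [c] and [s^-1 c] is named by the [true] side of the
   former; [across_side] identifies its face with that on the [false] side of the latter, so the
   rotation is [s^-1]. *)
have szVv : n * size Vv <= size K' + n * size (frontier K' false).
  rewrite -(size_map head_of (frontier K' false)).
  apply: (count_rotation (corner := fun yc => (mv yc.1 (yc.2, false), a yc.2))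
                         (r := s^-1%g)) _ _ (undup_uniq _) _ _.
  - move=> [y c] [y' c'] /= [eqy /perm_inj eqc]; rewrite -eqc in eqy *.
    by rewrite -(mvK y (c, false)) eqy mvK.
  - move=> d d'; rewrite -(eq_fconnect (finv_eq_can (permK s))).
    by rewrite (same_fconnect_finv perm_inj).
  - move=> y; rewrite mem_undup => /mapP[[x c] eE ->].
    have xE : mv (head_of (x, c)) (c, false) = x by apply: (mvK x (c, true)).
    move: eE; rewrite (mem_edges_of _ _ true) => /orP[] /= xK.
      by exists c; rewrite /= xE.
    by exists (s c); rewrite /= -invK' across_side permK xE.
  - move=> y c /=; rewrite -invK' across_side => inK nK.
    apply/mapP; exists (mv y ((s^-1)%g c, false), (s^-1)%g c).
      by rewrite mem_filter (mem_edges_of _ _ false) /side /= permKV inK nK.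
    by rewrite /head_of /= (mvK y (_, false)).
have := szE true; have := szE false; have := le_frontier true; have := le_frontier false.
rewrite /=; move: szVf szVv euler'.
move: (size E) (size Vf) (size Vv) => e vf vv.
move: (size (frontier K' true)) (size (frontier K' false)) => dt df.
move: le_size (size (frontier K true)) (size (frontier K false)).
move: (size K) (size K') => k k' *.
(* Replacing [n] by 8 makes the remaining goal linear; truncated subtraction is harmless, since the
   bound is trivial when [vf <= dt]. *)
have : 8 * (vf - dt) <= k' by apply: leq_trans (_ : n * (vf - dt) <= _); nia.
have : 8 * (vv - df) <= k' by apply: leq_trans (_ : n * (vv - df) <= _); nia.
lia.
Qed.

(** * From sets of faces to finite subgraphs *)

Definition edge_cls (e : cedge n) : corner := (pic e.1, e.2).

Lemma edge_cls_eq e e' : edge_cls e = edge_cls e' <-> cedge_eq s a e e'.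
Proof.
rewrite /edge_cls; split=> [[/picP h e2]|[e2 /picP h]]; first by split.
by rewrite e2 h.
Qed.

Lemma map_side_face e b : map edge_cls (side_face s a e b) = face (side (edge_cls e) b).
Proof.
rewrite /side_face /face_edges /face /side /edge_cls /opp_f /=.
by case: b => /=; rewrite !mv_pic -!cats1 -!catA.
Qed.

Lemma face_of_HP (H F : seq (cedge n)) :
  reflect (face_of_H s a H F) (all (mem (map edge_cls H)) (map edge_cls F)).
Proof.
apply: (iffP allP) => [FH e eF|FH _ /mapP[e /FH[e' e'H /edge_cls_eq ->] ->]]; last first.
  exact: map_f.
by have /mapP[e' e'H /edge_cls_eq] := FH _ (map_f _ eF); exists e'.
Qed.

Lemma face_across k : face (across k) =i face k.
Proof.
move=> e; case: k => x d; rewrite /face /=.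
have -> : opp_f (opp_f x d) (a d) = x by have [] := acrossK (x, d).
by rewrite !aK !inE; do 4!case: (e == _).
Qed.

(** Sides of a given kind determine their edges, so [2|H| <= 2|K| + |dH|]. A frontier edge of [K]
    belongs to [H] and its outer side is a boundary side, so [isoperimetric] gives
    [|K| <= 2|dH|]. *)
Lemma size_leq_boundary (H : seq (cedge n)) :
  8 <= n -> (forall d, a d != d) -> (forall d d', fconnect s d d') ->
  (forall d d', fconnect (fun x => s (a x)) d d') -> finite_edge_set s a H ->
  2 * size H <= 5 * #|boundary_sides s a H|.
Proof.
move=> n8 a_neq transs transf [_ injH].
pose E := map edge_cls H.
have uE : uniq E.
  pose e0 : cedge n := ([::], Ordinal (leq_trans (isT : 0 < 8) n8)).
  apply/(uniqP (edge_cls e0)) => i j; rewrite !inE size_map => ltiH ltjH.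
  rewrite !(nth_map e0) // => /edge_cls_eq.
  by have := injH (Ordinal ltiH) (Ordinal ltjH); rewrite !(tnth_nth e0) => h /h [].
(* A face of [H] contains its own first edge, so the [true] sides of [E] list all candidates. *)
pose K := [seq k <- map (side^~ true) E | all (mem E) (face k)].
have uK : uniq K by rewrite filter_uniq // map_inj_uniq //; apply: can_inj (sideK true).
have memK k : (k \in K) = all (mem E) (face k).
  rewrite mem_filter; case: allP => //= kE; apply/mapP.
  by exists (unside true k); rewrite ?(unsideK true) //; apply: kE; rewrite !inE eqxx.
have unsideE b k : k \in K -> unside b k \in E.
  by rewrite memK => /allP; apply; case: b; rewrite !inE eqxx ?orbT.
have invK k : (across k \in K) = (k \in K).
  by rewrite !memK; apply: eq_all_r; apply: face_across.
have := isoperimetric n8 a_neq transs transf uK invK.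
pose out b := count (fun e => side e b \notin K) E.
have frontier_out b : size (frontier K b) <= out (~~ b).
  rewrite /out -size_filter; apply: uniq_leq_size.
    by rewrite filter_uniq ?undup_uniq.
  move=> e; rewrite mem_filter => /andP[/andP[inb nb] _]; rewrite mem_filter nb /=.
  by have := unsideE b _ inb; rewrite (sideK b).
have szH b : size H <= size K + out b.
  rewrite -(size_map edge_cls) -(count_predC (fun e => side e b \in K)) leq_add2r.
  rewrite -size_filter -(size_map (side^~ b)); apply: uniq_leq_size.
    by rewrite map_inj_uniq ?filter_uniq //; apply: can_inj (sideK b).
  by move=> _ /mapP[e + ->]; rewrite mem_filter => /andP[].
have -> : #|boundary_sides s a H| = out true + out false.
  have outE b : out b = \sum_(i < size H) (side (edge_cls (tnth (in_tuple H) i)) b \notin K).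
    by rewrite /out -sum1_count big_map big_tnth big_mkcond; apply: eq_bigr => i _; case: ifP.
  rewrite !outE -big_split -sum1_card big_mkcond /=.
  rewrite (eq_bigr (fun x => if (x.1, x.2) \in boundary_sides s a H then 1 else 0)); last by case.
  rewrite -(pair_bigA _ (fun i b => if (i, b) \in boundary_sides s a H then 1 else 0)) /=.
  apply: eq_bigr => i _.
  have bsE b : ((i, b) \in boundary_sides s a H)
      = (side (edge_cls (tnth (in_tuple H) i)) b \notin K).
    by rewrite inE memK -map_side_face; congr (~~ _); apply/asboolP/face_of_HP.
  by rewrite big_bool /= !bsE; do 2!case: (_ \in K).
have := szH true; have := szH false.
have := frontier_out true; have := frontier_out false => /=; lia.
Qed.

End Cover.

Theorem theoremB1 (g : nat) (hg : 2 <= g) (s a : {perm 'I_(4 * g)})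
    (hmap : one_vertex_one_face_map s a)
    (H : seq (cedge (4 * g))) (hH : finite_edge_set s a H) :
  2 * size H <= 5 * #|boundary_sides s a H|.
Proof.
have [aK a_neq transs transf] := hmap.
apply: size_leq_boundary hH => //; lia.
Qed.
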